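(* Let $S$ be the set containing 6 copies of each odd positive integer and 6 more copies of each odd positive multiple of 3, and let $T$ be the set containing 6 copies of each even positive integer and 6 more copies of each positive multiple of 6. Let $D_S(N)$ be the number of partitions of $N$ into an odd number of distinct elements of $S$, and let $D_T(N)$ be the number of partitions of $N$ into distinct elements of $T$ (with no restriction on the number of parts). Then, for every integer $N\geq 3$, $$D_S(N)=32\,D_T(N-3).$$
   Context: A ''set containing several copies'' of certain integers means a set of colored integers: the different copies of the same integer are regarded as distinct (distinguishable) elements, each having that integer as its value. A partition of $N$ into distinct elements of $X$ is a finite subset of $X$ whose elements have values summing to $N$ (so each copy is used at most once, but different copies of the same integer may be used together, and subsets using different copies are counted as different); the number of parts is the cardinality of this subset. The empty partition is the unique partition of $0$ when no restriction on the number of parts is imposed. *)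

(* Defs.v *)
From mathcomp Require Import all_boot.
From mathcomp Require Import finmap.

Set Implicit Arguments.
Unset Strict Implicit.
Unset Printing Implicit Defensive.

(* The copy of the integer x.1 with colour x.2. *)
Definition colored (C : finType) := (nat * C)%type.

(* Colours in the left summand are the first 6 copies, those in the right
   summand are the 6 more copies. *)
Definition color := ('I_6 + 'I_6)%type.

Definition S_set : pred (colored color) := fun x =>
  match x.2 with
  | inl _ => (0 < x.1) && odd x.1
  | inr _ => [&& 0 < x.1, odd x.1 & 3 %| x.1]
  end.

Definition T_set : pred (colored color) := fun x =>
  match x.2 with
  | inl _ => (0 < x.1) && ~~ odd x.1
  | inr _ => (0 < x.1) && (6 %| x.1)
  end.

Definition is_partition (C : finType) (X : pred (colored C)) (N : nat)
    (A : {fset colored C}) : bool :=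
  all X A && (\sum_(x <- A) x.1 == N).

(* All colored integers of value at most N: the ambient set that makes the
   enumeration of partitions of N finite; see in_partitions. *)
Definition box (C : finType) (N : nat) : {fset colored C} :=
  [fset x in [seq (n, c) | n <- iota 0 N.+1, c <- enum C]]%fset.

Definition partitions (C : finType) (X : pred (colored C)) (N : nat) :
    {fset {fset colored C}} :=
  [fset A in fpowerset (box C N) | is_partition X N A]%fset.

(* The bound by box loses no partition, for any X. *)
Lemma in_partitions (C : finType) (X : pred (colored C)) (N : nat)
    (A : {fset colored C}) :
  (A \in partitions X N) = is_partition X N A.
Proof.
rewrite !inE /=; case: (boolP (is_partition X N A)) => [|_]; last by rewrite andbF.
case/andP => _ /eqP sumA; rewrite andbT fpowersetE; apply/fsubsetP => -[n c] Anc.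
have le_nN : n <= N by rewrite -sumA (big_rem (n, c)) //= leq_addr.
by rewrite in_fset; apply: allpairs_f; rewrite ?mem_enum // mem_iota.
Qed.

Definition D_S (N : nat) : nat :=
  #|` [fset A in partitions S_set N | odd #|` A|]|%fset.

Definition D_T (N : nat) : nat := #|` partitions T_set N|%fset.

(* Main.v *)
Require Import Defs.
From mathcomp Require Import all_boot all_order all_algebra finmap.
From mathcomp Require Import zify ring.

(** Write A(q) for the product of (1 + q^n)^2 (1 + q^(3n))^2 over odd n, put
    B(q) = A(-q), and let C(q) be the same product over even n.  The
    generating function of partitions into distinct elements of S is A^3, and
    that for T is C^3.  All parts from S are odd, so the number of parts has
    the parity of N and A^3 - B^3 generates 2 D_S(N).  The theorem is therefore
    the coefficientwise form of
<<
      A^3 - B^3 = 12 q + 64 q^3 C^3,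
>>
    the 12 q being responsible for the hypothesis on N.  It follows from
    Legendre's modular equation of degree 3, A - B = 4 q C
    ([prod_odd_even_prod]), and Euler's identity, which gives A B C = 1
    ([euler_odd_even]): indeed
    A^3 - B^3 = (A - B)^3 + 3 A B (A - B) = 64 q^3 C^3 + 12 q A B C.

    By the Jacobi triple product, A - B = 4 q C says, after multiplication by
    the Euler products in q^2 and q^6, that the theta series phi (exponents
    k^2) and psi (exponents k (k + 1)), both summed over all integers, satisfy
<<
      phi(q) phi(q^3) - phi(-q) phi(-q^3) = q psi(q) psi(q^3)
>>
    ([cubic_theta]).  The left side is twice the sum of q^(x^2 + 3 y^2) over the
    integer points with x + y odd.  The isometry
    (x, y) -> ((x + 3 y) / 2, (x - y) / 2) of the form x^2 + 3 y^2, a symmetry of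
    the hexagonal lattice, sends these points onto half of the points with two
    half-odd coordinates, and the reflection y -> -y gives the other half
    ([sum_tri_form_half]).

    Infinite products and series are avoided: everything takes place in an
    arbitrary commutative ring with a nilpotent element q, where all products
    and sums are eventually constant, and where 1 - q^i can be cancelled.  The
    triple product is then the limit of Cauchy's finite version
    ([finite_triple_product]).  Coefficients are recovered by taking q to be
    the class of 'X in Z[X] / X^(N+1). *)

Set Implicit Arguments.
Unset Strict Implicit.
Unset Printing Implicit Defensive.
Import GRing.Theory.
Local Open Scope ring_scope.

(** * Gaussian binomial coefficients and Cauchy's finite triple product *)

Definition qpoch (R : comNzRingType) (t : R) (n : nat) : R :=
  \prod_(i < n) (1 - t ^+ i.+1).

Fixpoint qbin (R : comNzRingType) (t : R) (n k : nat) : R :=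
  match n, k with
  | n'.+1, k'.+1 => qbin t n' k' + t ^+ k'.+1 * qbin t n' k'.+1
  | _, 0 => 1
  | 0, _.+1 => 0
  end.

Lemma qbin0 (R : comNzRingType) (t : R) n : qbin t n 0 = 1.
Proof. by case: n. Qed.

Lemma qbinS (R : comNzRingType) (t : R) n k :
  qbin t n.+1 k.+1 = qbin t n k + t ^+ k.+1 * qbin t n k.+1.
Proof. by []. Qed.

Lemma qbin_small (R : comNzRingType) (t : R) n k : (n < k)%N -> qbin t n k = 0.
Proof.
elim: n k => [|n IHn] [|k] //= lt_nk.
by rewrite !IHn ?mulr0 ?addr0 //; lia.
Qed.

(** The Pascal rule dual to the defining one; both are needed because the
    finite triple product grows at its two ends. *)
Lemma qbin_pascal (R : comNzRingType) (t : R) n k : (k <= n)%N ->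
  qbin t n.+1 k.+1 = qbin t n k.+1 + t ^+ (n - k) * qbin t n k.
Proof.
elim: n k => [|n IHn] k le_kn.
  case: k le_kn => [|k] // _; rewrite qbinS qbin0 subnn expr0 mulr1 qbin_small //.
  by rewrite mulr0 addrC.
rewrite qbinS; case: k le_kn => [|k] le_kn.
  rewrite {1}(IHn 0%N) // qbinS !qbin0 !subn0 (exprS t n) expr1.
  by ring.
have [/eqP ->|lt_kn] := boolP (k == n).
  rewrite subnn !(qbin_small t (_ : (_ < n.+2)%N)) //.
  by rewrite !mulr0 !add0r !mul1r !addr0.
rewrite {1}(IHn k.+1); last by lia.
rewrite {1}(IHn k) // !qbinS.
rewrite !mulrDr !mulrA -!exprD subSS.
have -> : (k.+2 + (n - k.+1) = n - k + k.+1)%N by lia.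
by ring.
Qed.

Lemma qpochS (R : comNzRingType) (t : R) n :
  qpoch t n.+1 = qpoch t n * (1 - t ^+ n.+1).
Proof. by rewrite /qpoch big_ord_recr. Qed.

(** The factorial formula (t)_k (t)_l [k + l, k] = (t)_(k + l), in a form that
    needs no division. *)
Lemma qbin_qpoch (R : comNzRingType) (t : R) k l :
  qbin t (k + l) k * qpoch t k * qpoch t l = qpoch t (k + l).
Proof.
elim: k l => [|k IHk] l; first by rewrite qbin0 /qpoch big_ord0 !mul1r.
elim: l => [|l IHl].
  rewrite addn0 qbinS (@qbin_small _ _ k k.+1) // mulr0 addr0.
  have := IHk 0%N; rewrite addn0 /qpoch big_ord0 !mulr1 => {}IHk.
  by rewrite big_ord_recr mulrA IHk.
have {IHk} := IHk l.+1; have Ek : (k.+1 + l.+1 = (k + l).+2)%N by lia.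
rewrite Ek addnS => IHk; rewrite addSn in IHl.
rewrite qbinS (qpochS t (k + l).+1); set P := qpoch t (k + l).+1 in IHk IHl *.
transitivity ((1 - t ^+ k.+1) * P + t ^+ k.+1 * (1 - t ^+ l.+1) * P).
  by rewrite -{1}IHk -IHl !qpochS; ring.
have -> : t ^+ (k + l).+2 = t ^+ k.+1 * t ^+ l.+1.
  by rewrite -exprD -Ek.
by ring.
Qed.

Lemma sum_qbinS (R : comNzRingType) (t : R) n (e : nat -> R) :
  \sum_(j < n.+2) qbin t n.+1 j * e j =
  \sum_(j < n.+1) qbin t n j * (e j.+1 + t ^+ j * e j).
Proof.
rewrite big_ord_recl qbin0.
under eq_bigr => j _ do rewrite qbinS mulrDl.
under [RHS]eq_bigr => j _ do rewrite mulrDr.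
rewrite !big_split /= addrCA; congr (_ + _).
rewrite big_ord_recr [in RHS]big_ord_recl /= qbin_small // qbin0.
rewrite mulr0 mul0r addr0 !mul1r; congr (_ + _).
by apply: eq_bigr => j _; rewrite mulrCA mulrA.
Qed.

Lemma sum_qbin_pascal (R : comNzRingType) (t : R) n (e : nat -> R) :
  \sum_(j < n.+2) qbin t n.+1 j * e j =
  \sum_(j < n.+1) qbin t n j * (e j + t ^+ (n - j) * e j.+1).
Proof.
rewrite big_ord_recl qbin0.
under eq_bigr => j _ do rewrite (qbin_pascal _ (ltn_ord j : (j <= n)%N)) mulrDl.
under [RHS]eq_bigr => j _ do rewrite mulrDr.
rewrite !big_split /= addrA; congr (_ + _).
  rewrite big_ord_recr [in RHS]big_ord_recl /= qbin_small // qbin0.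
  by rewrite mul0r addr0.
by apply: eq_bigr => j _; rewrite mulrCA mulrA.
Qed.

(** The triangular number k (k + 1) / 2 of an integer k; since it is invariant
    under k -> - 1 - k, both constructors of int get the same formula. *)
Definition tri (k : int) : nat :=
  match k with Posz n => 'C(n.+1, 2) | Negz n => 'C(n.+1, 2) end.

Lemma tri2 (k : int) : (tri k)%:Z * 2 = k * (k + 1).
Proof.
have bin n : (2 * 'C(n.+1, 2) = n.+1 * n)%N by rewrite -mul_bin_diag bin1.
by case: k => n /=; move: (bin n); lia.
Qed.

Lemma triB1 (k : int) : (tri (k - 1))%:Z = (tri k)%:Z - k.
Proof. by have := tri2 k; have := tri2 (k - 1); lia. Qed.

(** Cauchy's finite form of the Jacobi triple product, in Ramanujan's symmetric
    notation: the ratio t = a b and the two parameters occur without negative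
    powers, so that a and b need not be invertible.  The summation index is
    k = j - n.  Each new factor is absorbed by one of the two Pascal rules. *)
Lemma finite_triple_product (R : comNzRingType) (a b : R) (m n : nat) :
  \prod_(i < m) (1 + a * (a * b) ^+ i) *
  \prod_(i < n) (1 + b * (a * b) ^+ i) =
  \sum_(j < (m + n).+1) qbin (a * b) (m + n) j *
    (a ^+ tri (j%:Z - n%:Z) * b ^+ tri (j%:Z - n%:Z - 1)).
Proof.
elim: n => [|n IHn].
  elim: m => [|m IHm].
    by rewrite !big_ord0 big_ord1 /= !mulr1.
  move: IHm; rewrite !big_ord0 !mulr1 !addn0 => IHm.
  rewrite [X in X = _]big_ord_recr /= IHm.
  rewrite (sum_qbin_pascal _ _
    (fun j => a ^+ tri (j%:Z - 0) * b ^+ tri (j%:Z - 0 - 1))).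
  rewrite mulr_suml; apply: eq_bigr => j _; rewrite -mulrA; congr (_ * _).
  rewrite mulrDr mulr1; congr (_ + _).
  rewrite !exprMn [in RHS]mulrACA -!exprD.
  rewrite (mulrA a) -exprS mulrACA -!exprD.
  rewrite -[0%Z]/(0 : int) !subr0 (_ : j.+1%:Z - 1 = j%:Z); last by lia.
  have := ltn_ord j; have := triB1 j%:Z; have := triB1 j.+1%:Z.
  rewrite (_ : j.+1%:Z - 1 = j%:Z); last by lia.
  by move=> h1 h2 h3; congr (_ ^+ _ * _ ^+ _); lia.
rewrite big_ord_recr mulrA IHn addnS.
rewrite (sum_qbinS _ _
  (fun j => a ^+ tri (j%:Z - n.+1%:Z) * b ^+ tri (j%:Z - n.+1%:Z - 1))).
rewrite mulr_suml; apply: eq_bigr => j _; rewrite -mulrA; congr (_ * _).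
have -> : j.+1%:Z - n.+1%:Z = j%:Z - n%:Z by lia.
rewrite mulrDr mulr1; congr (_ + _).
rewrite !exprMn [in RHS]mulrACA -!exprD.
rewrite (mulrCA b) -exprS mulrACA -!exprD /=.
rewrite (_ : j%:Z - n.+1%:Z = j%:Z - n%:Z - 1); last by lia.
have := ltn_ord j; have := triB1 (j%:Z - n%:Z); have := triB1 (j%:Z - n%:Z - 1).
by move=> h1 h2 h3; congr (_ ^+ _ * _ ^+ _); lia.
Qed.

(** * The triple product at a nilpotent parameter *)

Lemma expr_nilp (R : comNzRingType) (x : R) M n :
  x ^+ M = 0 -> (M <= n)%N -> x ^+ n = 0.
Proof. by move=> xM le_Mn; rewrite -(subnKC le_Mn) exprD xM mul0r. Qed.

Lemma exprX_nilp (R : comNzRingType) (x : R) M m :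
  x ^+ M = 0 -> (0 < m)%N -> (x ^+ m) ^+ M = 0.
Proof. by move=> xM m_gt0; rewrite -exprM (expr_nilp xM) // leq_pmull. Qed.

(** The geometric series is finite, so 1 - x is invertible. *)
Lemma lreg_1B_nilp (R : comNzRingType) (x : R) M : x ^+ M = 0 -> GRing.lreg (1 - x).
Proof.
move=> xM; apply: (@GRing.lregMl _ (\sum_(i < M) x ^+ i)).
suff -> : (\sum_(i < M) x ^+ i) * (1 - x) = 1 by exact: lreg1.
by rewrite mulrC -opprB mulNr -subrX1 xM opprB subr0.
Qed.

Lemma lreg_qpoch (R : comNzRingType) (t : R) M n : t ^+ M = 0 -> GRing.lreg (qpoch t n).
Proof.
move=> tM; rewrite /qpoch; elim/big_ind: _ => [|x y|i _]; [exact: lreg1|exact: lregM|].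
by apply: (@lreg_1B_nilp _ _ M); apply: exprX_nilp.
Qed.

(** This is how infinite products are handled: the factors from rank M on are
    trivial, hence all sufficiently long products agree. *)
Lemma prod_nilp_stable (R : comNzRingType) (M m n : nat) (F : nat -> R) :
  (forall i, (M <= i)%N -> F i = 1) -> (M <= m)%N -> (M <= n)%N ->
  \prod_(i < m) F i = \prod_(i < n) F i.
Proof.
move=> F1; suff E k : (M <= k)%N -> \prod_(i < k) F i = \prod_(i < M) F i.
  by move=> le_Mm le_Mn; rewrite !E.
elim: k => [|k IHk]; first by rewrite leqn0 => /eqP ->.
rewrite leq_eqVlt => /predU1P[-> //|]; rewrite ltnS => le_Mk.
by rewrite big_ord_recr IHk //= F1 // mulr1.
Qed.

Lemma qpoch_stable (R : comNzRingType) (t : R) M m n : t ^+ M = 0 ->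
  (M <= m)%N -> (M <= n)%N -> qpoch t m = qpoch t n.
Proof.
move=> tM; apply: (@prod_nilp_stable _ M _ _ (fun i => 1 - t ^+ i.+1)) => i le_Mi.
by rewrite (expr_nilp tM) ?subr0 // ltnW.
Qed.

Definition zrange (n : nat) : seq int := [seq j%:Z - n%:Z | j <- iota 0 (n + n).+1].

Lemma mem_zrange n (k : int) : (k \in zrange n) = (`|k| <= n)%N.
Proof.
apply/mapP/idP => [[j]|le_kn]; first by rewrite mem_iota => lej ->; lia.
by exists (absz (k + n%:Z)); rewrite ?mem_iota; lia.
Qed.

Lemma zrange_uniq n : uniq (zrange n).
Proof. by rewrite map_inj_uniq ?iota_uniq // => i j; lia. Qed.

(** Limit of the finite triple product.  For |k| < M both n + k and n - k are at
    least M, so every q-factorial in the factorial formula equals the Euler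
    product, and the Gaussian coefficient is its inverse; the terms with
    |k| >= M vanish by assumption. *)
Lemma triple_product (R : comNzRingType) (a b : R) (M n : nat) :
  (a * b) ^+ M = 0 -> (M + M <= n)%N ->
  (forall k : int, (M <= `|k|)%N -> a ^+ tri k * b ^+ tri (k - 1) = 0) ->
  qpoch (a * b) n *
    (\prod_(i < n) (1 + a * (a * b) ^+ i) * \prod_(i < n) (1 + b * (a * b) ^+ i)) =
  \sum_(k <- zrange n) a ^+ tri k * b ^+ tri (k - 1).
Proof.
move=> tM le_Mn ab0; rewrite finite_triple_product mulr_sumr big_map.
rewrite -[iota 0 _]/(index_iota 0 (n + n).+1) big_mkord.
apply: eq_bigr => j _; rewrite mulrA.
have [le_Mj|lt_jM] := leqP M `|j%:Z - n%:Z|; first by rewrite ab0 ?mulr0.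
suff -> : qpoch (a * b) n * qbin (a * b) (n + n) j = 1 by rewrite mul1r.
apply: (lreg_qpoch (n := n) tM); rewrite mulr1.
have := qbin_qpoch (a * b) j (n + n - j).
rewrite subnKC; last by have := ltn_ord j; lia.
rewrite !(@qpoch_stable _ _ M _ n tM); try lia.
by move=> h; rewrite -[RHS]h; ring.
Qed.

Definition odd_prod (R : comNzRingType) (x : R) (n : nat) : R :=
  \prod_(i < n) (1 + x ^+ i.*2.+1).

Definition even_prod (R : comNzRingType) (x : R) (n : nat) : R :=
  \prod_(i < n) (1 + x ^+ i.*2.+2).

(** Triple product at a = b = q, where tri k + tri (k - 1) = k^2. *)
Lemma theta_odd_prod (R : comNzRingType) (q : R) M n :
  q ^+ M = 0 -> (M + M <= n)%N ->
  qpoch (q ^+ 2) n * odd_prod q n ^+ 2 = \sum_(k <- zrange n) q ^+ (`|k| ^ 2).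
Proof.
move=> qM le_Mn.
have triD (k : int) : q ^+ tri k * q ^+ tri (k - 1) = q ^+ (`|k| ^ 2).
  by rewrite -exprD; congr (_ ^+ _); have := triB1 k; have := tri2 k; nia.
have := @triple_product _ q q M n; rewrite -expr2 exprX_nilp // => /(_ erefl le_Mn).
rewrite (eq_bigr _ (fun k _ => triD k)).
move=> <- => [|k le_Mk].
  by congr (_ * _); rewrite /odd_prod -expr2; congr (_ ^+ 2); apply: eq_bigr => i _;
     rewrite -exprM mul2n -exprS.
by rewrite triD (expr_nilp qM) //; nia.
Qed.

(** Triple product at a = q^2 and b = 1: the factor 2 is the term i = 0 of the
    product in b, whose other factors repeat those of the product in a. *)
Lemma psi_even_prod (R : comNzRingType) (q : R) M n :
  q ^+ M = 0 -> (M.+1 + M.+1 <= n)%N ->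
  qpoch (q ^+ 2) n * (2 * even_prod q n ^+ 2) = \sum_(k <- zrange n) q ^+ (tri k).*2.
Proof.
move=> qM le_Mn.
have triD (k : int) : (q ^+ 2) ^+ tri k * 1 ^+ tri (k - 1) = q ^+ (tri k).*2.
  by rewrite expr1n mulr1 -exprM mul2n.
have := @triple_product _ (q ^+ 2) 1 M.+1 n; rewrite mulr1 -exprM.
rewrite (expr_nilp qM); last by lia.
move=> /(_ erefl le_Mn); rewrite (eq_bigr _ (fun k _ => triD k)).
move=> <- => [|k le_Mk]; last first.
  by rewrite triD (expr_nilp qM) //; have := tri2 k; nia.
congr (_ * _); rewrite [even_prod q n ^+ 2]expr2 mulrCA; congr (_ * _).
  by apply: eq_bigr => i _; rewrite -exprM -exprD; congr (1 + q ^+ _); lia.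
case: n le_Mn => // n le_Mn.
rewrite [in RHS]big_ord_recl expr0 mulr1; congr (_ * _).
rewrite /even_prod big_ord_recr /= (expr_nilp qM) ?addr0 ?mulr1; last by lia.
by apply: eq_bigr => i _; rewrite mul1r -exprM; congr (1 + q ^+ _); rewrite /bump; lia.
Qed.

(** * Reindexing the cubic theta identity *)

(** Sums of powers of a nilpotent q only see exponents below M.  Hence a bijection
    of index sets that preserves exponents gives equal sums over a finite window
    s, even if it does not preserve s. *)
Lemma reindex_nilp (R : comNzRingType) (q : R) (M : nat) (I : eqType) (s : seq I)
    (P P' : pred I) (d d' : I -> nat) (h h' : I -> I) :
  q ^+ M = 0 -> uniq s ->
  (forall p, P p -> [/\ P' (h p), d' (h p) = d p & h' (h p) = p]) ->
  (forall p, P' p -> P (h' p) /\ h (h' p) = p) ->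
  (forall p, P p -> (d p < M)%N -> p \in s) ->
  (forall p, P' p -> (d' p < M)%N -> p \in s) ->
  \sum_(p <- s | P p) q ^+ d p = \sum_(p <- s | P' p) q ^+ d' p.
Proof.
move=> qM s_uniq hP hP' Ps P's.
have cut (Q : pred I) (e : I -> nat) : \sum_(p <- s | Q p) q ^+ e p =
    \sum_(p <- [seq p <- s | Q p && (e p < M)%N]) q ^+ e p.
  rewrite big_filter [RHS]big_mkcondr; apply: eq_bigr => p _.
  by case: ltnP => // /(expr_nilp qM).
rewrite !cut.
rewrite [RHS](perm_big [seq h p | p <- [seq p <- s | P p && (d p < M)%N]]) /=.
  rewrite big_map big_filter [RHS]big_filter; apply: eq_bigr => p /andP[Pp _].
  by have [_ -> _] := hP _ Pp.
apply: uniq_perm; rewrite ?filter_uniq //.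
  rewrite map_inj_in_uniq ?filter_uniq // => x y.
  rewrite !mem_filter => /andP[/andP[Px _] _] /andP[/andP[Py _] _] E.
  by have [_ _ <-] := hP _ Px; have [_ _ <-] := hP _ Py; rewrite E.
move=> x; rewrite mem_filter; apply/andP/mapP => [[/andP[P'x lt_xM] _]|[p]].
  have [Px hx] := hP' _ P'x; have [_ dx _] := hP _ Px.
  by exists (h' x) => //; rewrite mem_filter Px -dx hx lt_xM /= Ps // -dx hx.
rewrite mem_filter => /andP[/andP[Pp lt_pM] _ ->].
by have [P'h dh _] := hP _ Pp; rewrite P'h dh lt_pM; split=> //;
  apply: P's; rewrite ?dh.
Qed.

Definition zpairs n : seq (int * int) := [seq (k, l) | k <- zrange n, l <- zrange n].

Lemma mem_zpairs n k l : ((k, l) \in zpairs n) = (`|k| <= n)%N && (`|l| <= n)%N.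
Proof.
rewrite -!mem_zrange.
by apply/allpairsP/andP => [[[x y] /= [? ? [-> ->]]]|[? ?]]; [|exists (k, l)].
Qed.

Lemma zpairs_uniq n : uniq (zpairs n).
Proof. by apply: allpairs_uniq; rewrite ?zrange_uniq // => -[? ?] [? ?]. Qed.

Definition odd_sum (p : int * int) : bool := odd `|p.1 + p.2|.

Definition sq_form (p : int * int) : nat := (`|p.1| ^ 2 + 3 * `|p.2| ^ 2)%N.
(** The form u^2 + 3 v^2 at the half-odd point u = p.1 + 1/2, v = p.2 + 1/2. *)
Definition tri_form (p : int * int) : nat := ((tri p.1).*2 + 3 * (tri p.2).*2).+1.

Lemma sq_formE p : (sq_form p)%:Z = p.1 * p.1 + 3 * (p.2 * p.2).
Proof.
have sq (x : int) : ((`|x| ^ 2)%N)%:Z = x * x by lia.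
by rewrite /sq_form PoszD PoszM !sq.
Qed.

Lemma tri_formE p : (tri_form p)%:Z = p.1 * (p.1 + 1) + 3 * (p.2 * (p.2 + 1)) + 1.
Proof. by rewrite /tri_form -!tri2; lia. Qed.

Definition half_sum (p : int * int) : int := ((p.1 + p.2) %/ 2)%Z.

Lemma half_sumE p : p.1 + p.2 = 2 * half_sum p + odd_sum p.
Proof.
case: p => x y; rewrite /odd_sum /half_sum /=.
by have := odd_double_half `|x + y|; case: odd => /=; lia.
Qed.

(** Euclidean division of p.1 + p.2 by 2 determines both the half sum, in
    terms of which the isometry is written, and the parity class. *)
Lemma half_sum_uniq (p : int * int) (c : int) (b : bool) :
  p.1 + p.2 = 2 * c + b -> half_sum p = c /\ odd_sum p = b.
Proof. by have := half_sumE p; case: b; case: odd_sum => /=; split; lia. Qed.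

(** The isometry (x, y) -> ((x + 3 y) / 2, (x - y) / 2) preserves x^2 + 3 y^2 and
    sends integer points with x + y odd to half-odd points (u, v).  In the
    coordinates u - 1/2 and v - 1/2 the image consists of the points with even
    sum (b = false); composing with v -> - v gives those with odd sum
    (b = true). *)
Lemma sum_tri_form_half (R : comNzRingType) (q : R) M n (b : bool) :
  q ^+ M = 0 -> (M <= n)%N ->
  \sum_(p <- zpairs n | odd_sum p) q ^+ sq_form p =
  \sum_(p <- zpairs n | odd_sum p == b) q ^+ tri_form p.
Proof.
move=> qM le_Mn.
(* The isometry, followed by the reflection if b holds, and its inverse; on
   points of odd sum 2 c + 1 the former is (c + y, c - y) or (c + y, y - c - 1). *)
pose h (p : int * int) : int * int :=
  (half_sum p + p.2, if b then p.2 - half_sum p - 1 else half_sum p - p.2).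
pose h' (p : int * int) : int * int := if b then (half_sum p - 2 * p.2, half_sum p + 1)
  else (half_sum p + p.2 + 1, half_sum p - p.2).
apply: (@reindex_nilp _ _ M _ _ _ _ _ _ h h' qM (zpairs_uniq n)).
- move=> [x y] oddp; have := half_sumE (x, y); rewrite oddp.
  set c := half_sum (x, y) => /= xy.
  have {xy} E : x = 2 * c + 1 - y by lia.
  have [|hh oh] := @half_sum_uniq (h (x, y)) (if b then y - 1 else c) b.
    by rewrite /h -/c /=; case: (b) => /=; lia.
  split; first by rewrite oh.
    apply/eqP; rewrite -eqz_nat sq_formE tri_formE /h -/c /= E; apply/eqP.
    by case: (b); ring.
  by rewrite /h' hh /h -/c /= E; case: (b); congr (_, _); ring.
- move=> [x y] /eqP oddp; have := half_sumE (x, y); rewrite oddp.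
  set c := half_sum (x, y) => /= xy.
  have [|hh oh] := @half_sum_uniq (h' (x, y)) (if b then c - y else c) true.
    by rewrite /h' -/c /=; case: (b) => /=; lia.
  split; first by rewrite oh.
  by rewrite /h hh /h' -/c /=; case: (b) xy => /= xy; congr (_, _); lia.
- by move=> [x y] _; rewrite mem_zpairs; have /= := sq_formE (x, y); nia.
- by move=> [x y] _; rewrite mem_zpairs; have /= := tri_formE (x, y); nia.
Qed.

Lemma odd_sq_form p : odd (sq_form p) = odd_sum p.
Proof.
case: p => x y; rewrite /sq_form /odd_sum /= oddD oddM !oddX /=.
have := odd_double_half `|x|; have := odd_double_half `|y|.
have := odd_double_half `|x + y|.
by case: odd; case: odd; case: odd => /=; lia.
Qed.

(** On the left the terms with x + y even cancel and the others double; on the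
    right the two parity classes of points contribute equally. *)
Lemma cubic_theta (R : comNzRingType) (q : R) M n :
  q ^+ M = 0 -> (M <= n)%N ->
  let phi x := \sum_(k <- zrange n) x ^+ (`|k| ^ 2) in
  let psi x := \sum_(k <- zrange n) x ^+ (tri k).*2 in
  phi q * phi (q ^+ 3) - phi (- q) * phi ((- q) ^+ 3) = q * (psi q * psi (q ^+ 3)).
Proof.
move=> qM le_Mn phi psi.
have phiE x : phi x * phi (x ^+ 3) = \sum_(p <- zpairs n) x ^+ sq_form p.
  rewrite /phi big_distrlr /= big_allpairs /=.
  by apply: eq_bigr => k _; apply: eq_bigr => l _; rewrite -exprM -exprD.
have psiE : q * (psi q * psi (q ^+ 3)) = \sum_(p <- zpairs n) q ^+ tri_form p.
  rewrite /psi big_distrlr mulr_sumr /= big_allpairs /=.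
  apply: eq_bigr => k _; rewrite mulr_sumr; apply: eq_bigr => l _.
  by rewrite -exprM -exprD -exprS.
rewrite psiE !phiE [RHS](bigID (fun p => odd_sum p == true)) /=.
rewrite -(sum_tri_form_half true qM le_Mn).
have -> : \sum_(p <- zpairs n | odd_sum p != true) q ^+ tri_form p =
    \sum_(p <- zpairs n | odd_sum p) q ^+ sq_form p.
  rewrite (sum_tri_form_half false qM le_Mn).
  by apply: eq_bigl => p; case: odd_sum.
rewrite -sumrB (bigID odd_sum) /= [X in _ + X]big1 ?addr0 => [|p even_p].
  rewrite -big_split /=; apply: eq_bigr => p odd_p.
  by rewrite exprNn -signr_odd odd_sq_form odd_p expr1 mulN1r opprK.
by rewrite exprNn -signr_odd odd_sq_form (negbTE even_p) mul1r subrr.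
Qed.

(** * The modular equation of degree 3 *)

(** The modular equation A - B = 4 q C: the triple product turns the cubic theta
    identity into this one, multiplied by two Euler products. *)
Lemma prod_odd_even_prod (R : comNzRingType) (q : R) M n :
  q ^+ M = 0 -> (M.+1 + M.+1 <= n)%N ->
  odd_prod q n ^+ 2 * odd_prod (q ^+ 3) n ^+ 2
    - odd_prod (- q) n ^+ 2 * odd_prod ((- q) ^+ 3) n ^+ 2
  = 4 * q * (even_prod q n ^+ 2 * even_prod (q ^+ 3) n ^+ 2).
Proof.
move=> qM le_Mn.
have NqM : (- q) ^+ M = 0 by rewrite exprNn qM mulr0.
have q2M : (q ^+ 2) ^+ M = 0 by rewrite exprX_nilp.
have q3M : (q ^+ 3) ^+ M = 0 by rewrite exprX_nilp.
have Nq3M : ((- q) ^+ 3) ^+ M = 0 by rewrite exprX_nilp.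
have q32M : ((q ^+ 3) ^+ 2) ^+ M = 0 by rewrite exprX_nilp.
apply: (lregM (lreg_qpoch (n := n) q2M) (lreg_qpoch (n := n) q32M)).
have le_2Mn : (M + M <= n)%N by lia.
have le_1Mn : (M <= n)%N by lia.
have := cubic_theta qM le_1Mn; rewrite /=.
rewrite -!(theta_odd_prod _ le_2Mn) // -!(psi_even_prod _ le_Mn) //.
have -> : ((- q) ^+ 3) ^+ 2 = (q ^+ 3) ^+ 2 by ring.
rewrite sqrrN => E.
by transitivity (q *
  (qpoch (q ^+ 2) n * (2 * even_prod q n ^+ 2) *
   (qpoch (q ^+ 3 ^+ 2) n * (2 * even_prod (q ^+ 3) n ^+ 2)))); [rewrite -E|]; ring.
Qed.

Lemma prod_blocks (R : comNzRingType) (F : nat -> R) m n :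
  \prod_(i < n * m) F i = \prod_(i < n) \prod_(r < m) F (i * m + r)%N.
Proof.
elim: n => [|n IHn]; first by rewrite !big_ord0.
by rewrite big_ord_recr -IHn mulSn addnC big_split_ord.
Qed.

(** Euler: the partitions into distinct and into odd parts are equinumerous.  In
    terms of Euler products with t = q^2, the product of the 1 + t^i is
    (t^2) / (t) and the product of the 1 - t^(2 i + 1) is (t) / (t^2). *)
Lemma euler_odd_even (R : comNzRingType) (q : R) M n :
  q ^+ M = 0 -> (M <= n)%N ->
  odd_prod q n * odd_prod (- q) n * even_prod q n = 1.
Proof.
move=> qM le_Mn.
have q2M : (q ^+ 2) ^+ M = 0 by rewrite exprX_nilp.
pose W := \prod_(i < n) (1 - (q ^+ 2) ^+ i.*2.+1).
have -> : odd_prod q n * odd_prod (- q) n = W.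
  rewrite -big_split; apply: eq_bigr => i _ /=.
  rewrite exprNn -signr_odd /= odd_double expr1 -exprM mulnC exprM.
  by ring.
have VE : even_prod q n * qpoch (q ^+ 2) n = qpoch ((q ^+ 2) ^+ 2) n.
  rewrite -big_split; apply: eq_bigr => i _ /=.
  by rewrite -doubleS -mul2n exprM [in RHS]exprAC; ring.
have WE : W * qpoch ((q ^+ 2) ^+ 2) n = qpoch (q ^+ 2) n.
  rewrite (@qpoch_stable _ (q ^+ 2) M n (n * 2) q2M) //; last by lia.
  rewrite [RHS](prod_blocks (fun i => 1 - q ^+ 2 ^+ i.+1)) -big_split.
  apply: eq_bigr => i _; rewrite big_ord_recl big_ord1 /= addn0 muln2.
  by rewrite -(exprM (q ^+ 2)) mul2n doubleS /bump addn1.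
apply: (lreg_qpoch (n := n) q2M).
by rewrite mulr1 mulrC -mulrA VE.
Qed.

(** The cube of the modular equation; A B C = 1 by Euler's identity at q and
    at q^3. *)
Lemma modular_equation (R : comNzRingType) (q : R) M n :
  q ^+ M = 0 -> (M.+1 + M.+1 <= n)%N ->
  odd_prod q n ^+ 6 * odd_prod (q ^+ 3) n ^+ 6
    - odd_prod (- q) n ^+ 6 * odd_prod ((- q) ^+ 3) n ^+ 6
  = 12 * q + 64 * q ^+ 3 * (even_prod q n ^+ 6 * even_prod (q ^+ 3) n ^+ 6).
Proof.
move=> qM le_Mn; have := prod_odd_even_prod qM le_Mn.
have le_1Mn : (M <= n)%N by lia.
have := euler_odd_even qM le_1Mn.
have q3M : (q ^+ 3) ^+ M = 0 by rewrite exprX_nilp.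
have := euler_odd_even q3M le_1Mn.
have -> : (- q) ^+ 3 = - q ^+ 3 by ring.
move: (odd_prod q n) (odd_prod (- q) n) (odd_prod (q ^+ 3) n) (odd_prod (- q ^+ 3) n).
move: (even_prod q n) (even_prod (q ^+ 3) n) => c c3 a b a3 b3 abc3 abc ab.
set A := a ^+ 2 * a3 ^+ 2 in ab; set B := b ^+ 2 * b3 ^+ 2 in ab.
set C := c ^+ 2 * c3 ^+ 2 in ab.
have ABC : A * B * C = 1.
  transitivity ((a * b * c) ^+ 2 * (a3 * b3 * c3) ^+ 2).
    by rewrite /A /B /C; ring.
  by rewrite abc abc3 !expr1n mulr1.
transitivity (A ^+ 3 - B ^+ 3); first by rewrite /A /B; ring.
transitivity ((A - B) ^+ 3 + 3 * A * B * (A - B)); first by ring.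
rewrite ab; transitivity (64 * q ^+ 3 * C ^+ 3 + 12 * q * (A * B * C)); first by ring.
by rewrite ABC /C; ring.
Qed.

(** * Generating functions of partitions into distinct parts *)

(** Expanding the product over B: a choice of one summand in each factor is a
    subset of B. *)
Lemma sum_fpowerset (R : comNzRingType) (K : choiceType) (B : {fset K}) (F : K -> R) :
  \sum_(A <- fpowerset B) \prod_(x <- A) F x = \prod_(x <- B) (1 + F x).
Proof.
rewrite [RHS]big_seq_fsetE; under [RHS]eq_bigr => i _ do rewrite addrC.
rewrite [RHS]bigA_distr big_imfset /=; last first.
  move=> Y Z _ _ /fsetP E; apply/setP => x.
  by have := E (val x); rewrite !mem_imfset //=; exact: val_inj.
rewrite big_enum; apply: eq_big => [Y|Y _]; first by rewrite powersetE subsetT.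
rewrite -big_mkcond big_imfset /=; last by move=> x y _ _; exact: val_inj.
by rewrite big_enum.
Qed.

(** The generating function of partitions into distinct elements of X whose
    values are less than L. *)
Definition part_prod (R : comNzRingType) (C : finType) (X : pred (colored C))
    (L : nat) (x : R) : R :=
  \prod_(n < L) \prod_(c : C) (if X (val n, c) then 1 + x ^+ n else 1).

Lemma prod_box (R : comNzRingType) (C : finType) (L : nat) (F : colored C -> R) :
  \prod_(x <- box C L) F x = \prod_(n < L.+1) \prod_(c : C) F (val n, c).
Proof.
rewrite big_imfset //=.
rewrite -[X in undup X]/([seq (n, c) | n <- iota 0 L.+1, c <- enum C]).
rewrite undup_id; last first.
  by apply: allpairs_uniq; rewrite ?iota_uniq ?enum_uniq // => -[? ?] [? ?].
rewrite big_allpairs -[iota 0 L.+1]/(index_iota 0 L.+1) big_mkord.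
by apply: eq_bigr => n _; rewrite big_enum.
Qed.

Lemma part_prodE (R : comNzRingType) (C : finType) (X : pred (colored C))
    (L : nat) (x : R) :
  part_prod X L.+1 x =
  \sum_(A <- fpowerset (box C L) | all X A) x ^+ (\sum_(y <- A) y.1)%N.
Proof.
transitivity (\prod_(y <- box C L) (1 + (if X y then x ^+ y.1 else 0))).
  rewrite prod_box; apply: eq_bigr => n _; apply: eq_bigr => c _ /=.
  by case: (X _); rewrite ?addr0.
rewrite -sum_fpowerset [RHS]big_mkcond; apply: eq_bigr => A _.
elim: (enum_fset A) => [|y s IHs]; first by rewrite !big_nil.
by rewrite !big_cons IHs /= exprD; case: (X y); case: (all X s); rewrite ?mul0r ?mulr0.
Qed.

(** Any large enough box enumerates the same partitions, which allows one bound
    to be used for N and for N - 3. *)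
Lemma partitions_box (C : finType) (X : pred (colored C)) (N L : nat) :
  (N <= L)%N ->
  partitions X N = [fset A in fpowerset (box C L) | is_partition X N A]%fset.
Proof.
move=> le_NL; apply/fsetP => A; rewrite in_partitions !inE /= andb_idl // => partA.
have : A \in partitions X N by rewrite in_partitions.
rewrite !inE /= => /andP[]; rewrite !fpowersetE => AN _.
apply: fsubset_trans AN _; apply/fsubsetP => -[n c].
rewrite !in_fset => /allpairsP[p [pN pC ->]]; apply/allpairsP; exists p; split=> //.
by move: pN; rewrite !mem_iota; lia.
Qed.

(** The scalar s = -1 gives the series at - q, as needed to separate parities. *)
Lemma coef_part_prod (C : finType) (X : pred (colored C)) (N L : nat) (s : int) :
  (N < L)%N ->
  (part_prod X L (s *: 'X))`_N = s ^+ N * (#|` partitions X N|)%fset%:R.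
Proof.
case: L => // L; rewrite ltnS => le_NL.
rewrite part_prodE coef_sum (partitions_box _ le_NL) card_fset_sum1 big_fset /=.
rewrite natr_sum mulr_sumr [RHS]big_mkcondl [LHS]big_mkcond [RHS]big_mkcond /=.
apply: eq_bigr => A _; case: (all X A); last by case: ifP.
rewrite exprZn coefZ coefXn eq_sym.
by case: eqP => [->|_]; rewrite ?mulr0.
Qed.

Lemma eq_coef_in_qpoly (A : comNzRingType) (M i : nat) (p p' : {poly A}) :
  in_qpoly 'X^M p = in_qpoly 'X^M p' -> (i < M)%N -> p`_i = p'`_i.
Proof.
case: M => // M E lt_iM.
have mulh0 (u : {poly A}) : (u * mk_monic 'X^(M.+1))`_i = 0.
  by rewrite mk_monic_Xn coefMXn lt_iM.
have modE (u : {poly A}) : u`_i = (in_qpoly 'X^(M.+1) u : {poly A})`_i.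
  rewrite {1}(Pdiv.RingMonic.rdivp_eq (monic_mk_monic 'X^(M.+1)) u) coefD.
  by rewrite mulh0 add0r.
by rewrite (modE p) (modE p') E.
Qed.

Lemma odd_prod_stable (R : comNzRingType) (x : R) M m n :
  x ^+ M = 0 -> (M <= m)%N -> (M <= n)%N -> odd_prod x m = odd_prod x n.
Proof.
move=> xM; apply: (@prod_nilp_stable _ M _ _ (fun i => 1 + x ^+ i.*2.+1)) => i le_Mi.
by rewrite (expr_nilp xM) ?addr0 //; lia.
Qed.

Lemma even_prod_stable (R : comNzRingType) (x : R) M m n :
  x ^+ M = 0 -> (M <= m)%N -> (M <= n)%N -> even_prod x m = even_prod x n.
Proof.
move=> xM; apply: (@prod_nilp_stable _ M _ _ (fun i => 1 + x ^+ i.*2.+2)) => i le_Mi.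
by rewrite (expr_nilp xM) ?addr0 //; lia.
Qed.

(** Among 2 d consecutive integers starting at a multiple of 2 d, only the one in
    position d is an odd multiple of d. *)
Lemma prod_odd_multiples (R : comNzRingType) (x : R) (d n : nat) : odd d ->
  \prod_(i < n * d.*2) (if odd i && (d %| i)%N then 1 + x ^+ i else 1) =
  odd_prod (x ^+ d) n.
Proof.
move=> odd_d.
have lt_d : (d < d.*2)%N by case: d odd_d => // d _; lia.
have dvd_d2 : (d %| d.*2)%N by rewrite -muln2 dvdn_mulr.
rewrite (prod_blocks (fun i => if odd i && (d %| i)%N then 1 + x ^+ i else 1)).
apply: eq_bigr => i _; rewrite (bigD1 (Ordinal lt_d)) //= big1 => [|r ne_rd].
  rewrite oddD -doubleMr odd_double odd_d doubleMr dvdn_add ?dvdn_mull // mulr1 /=.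
  by rewrite -exprM; congr (1 + x ^+ _); lia.
rewrite oddD -doubleMr odd_double doubleMr dvdn_addr ?dvdn_mull //=.
case: ifP => // /andP[odd_r].
case/dvdnP => k rE; case/eqP: ne_rd; apply/val_inj => /=.
by have := ltn_ord r; rewrite rE in odd_r *; case: k odd_r {rE} => [|[|k]] //; nia.
Qed.

Lemma prod_even_multiples (R : comNzRingType) (x : R) (d n : nat) : (0 < d)%N ->
  \prod_(i < n.+1 * d.*2) (if (0 < i)%N && (d.*2 %| i)%N then 1 + x ^+ i else 1) =
  even_prod (x ^+ d) n.
Proof.
move=> d_gt0.
have lt_d : (0 < d.*2)%N by lia.
rewrite (prod_blocks (fun i => if (0 < i)%N && (d.*2 %| i)%N then 1 + x ^+ i else 1)).
have blockE i : \prod_(r < d.*2) (if (0 < i * d.*2 + r)%N && (d.*2 %| i * d.*2 + r)%N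
    then 1 + x ^+ (i * d.*2 + r) else 1) = if (0 < i)%N then 1 + x ^+ (i * d.*2) else 1.
  rewrite (bigD1 (Ordinal lt_d)) //= big1 => [|r ne_r0].
    by rewrite addn0 mulr1 dvdn_mull // andbT muln_gt0 lt_d andbT.
  rewrite dvdn_addr ?dvdn_mull // gtnNdvd ?andbF //.
  by rewrite lt0n; apply: contraNneq ne_r0 => r0; apply/eqP/val_inj.
under eq_bigr => i _ do rewrite blockE.
rewrite big_ord_recl mul1r.
by apply: eq_bigr => i _ /=; rewrite -exprM; congr (1 + x ^+ _); rewrite /bump; lia.
Qed.

Lemma prod_six_plus_six (R : comNzRingType) (L : nat) (F G : nat -> R) :
  \prod_(n < L) \prod_(c : 'I_6 + 'I_6) (if c is inl _ then F n else G n) =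
  (\prod_(n < L) F n) ^+ 6 * (\prod_(n < L) G n) ^+ 6.
Proof.
rewrite -!prodrXl -big_split; apply: eq_bigr => n _ /=.
by rewrite big_sumType /= !prodr_const card_ord.
Qed.

(** The length n * 6 is a common multiple of the periods 2 and 6 of the two
    conditions on odd parts. *)
Lemma part_prod_S (R : comNzRingType) (x : R) M n :
  x ^+ M = 0 -> (M <= n)%N ->
  part_prod S_set (n * 6) x = odd_prod x n ^+ 6 * odd_prod (x ^+ 3) n ^+ 6.
Proof.
move=> xM le_Mn.
transitivity (\prod_(i < n * 6) \prod_(c : 'I_6 + 'I_6)
    (if c is inl _ then (if odd i && (1 %| i)%N then 1 + x ^+ i else 1)
     else (if odd i && (3 %| i)%N then 1 + x ^+ i else 1))).
  apply: eq_bigr => i _; apply: eq_bigr => -[] c _; rewrite /S_set /=.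
    by rewrite dvd1n andbT; case: (val i).
  by case: (val i).
rewrite (prod_six_plus_six _ (fun i => if odd i && (1 %| i)%N then 1 + x ^+ i else 1)
  (fun i => if odd i && (3 %| i)%N then 1 + x ^+ i else 1)).
rewrite (@prod_odd_multiples _ x 3) //; congr (_ ^+ 6 * _).
rewrite (_ : (n * 6 = (n * 3) * 1.*2)%N) ?prod_odd_multiples ?expr1 //; last by lia.
by apply: odd_prod_stable xM _ _; lia.
Qed.

Lemma part_prod_T (R : comNzRingType) (x : R) M n :
  x ^+ M = 0 -> (M < n)%N ->
  part_prod T_set (n * 6) x = even_prod x n ^+ 6 * even_prod (x ^+ 3) n ^+ 6.
Proof.
move=> xM lt_Mn.
transitivity (\prod_(i < n * 6) \prod_(c : 'I_6 + 'I_6)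
    (if c is inl _ then (if (0 < i)%N && (2 %| i)%N then 1 + x ^+ i else 1)
     else (if (0 < i)%N && (6 %| i)%N then 1 + x ^+ i else 1))).
  by apply: eq_bigr => i _; apply: eq_bigr => -[] c _; rewrite /T_set //= dvdn2.
rewrite (prod_six_plus_six _
  (fun i => if (0 < i)%N && (2 %| i)%N then 1 + x ^+ i else 1)
  (fun i => if (0 < i)%N && (6 %| i)%N then 1 + x ^+ i else 1)).
case: n lt_Mn => // n lt_Mn; congr (_ ^+ 6 * _ ^+ 6); last first.
  rewrite (@prod_even_multiples _ x 3) //.
  by apply: (@even_prod_stable _ _ M); rewrite ?exprX_nilp //; lia.
rewrite (_ : (n.+1 * 6 = (n * 3 + 2).+1 * 1.*2)%N); last by lia.
rewrite prod_even_multiples // expr1.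
by apply: even_prod_stable xM _ _; lia.
Qed.

(** All elements of S are odd, so the number of parts of a partition of N has
    the parity of N. *)
Lemma D_S_parity N : D_S N = (odd N * #|` partitions S_set N|)%fset%N.
Proof.
have parity A : A \in partitions S_set N -> odd #|` A|%fset = odd N.
  rewrite in_partitions => /andP[/allP SA /eqP <-].
  rewrite card_fset_sum1; move: SA; elim: (enum_fset A) => [|[m c] s IHs] SA.
    by rewrite !big_nil.
  rewrite !big_cons !oddD IHs => [|y ys]; last by apply: SA; rewrite inE ys orbT.
  congr (_ (+) _); have := SA (m, c); rewrite inE eqxx => /(_ isT) {SA}.
  by rewrite /S_set /=; case: c => _; [case/andP|case/and3P] => _ ->.
rewrite /D_S (_ : [fset A in partitions S_set N | odd #|` A|]%fset =
  if odd N then partitions S_set N else fset0).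
  by case: odd; rewrite ?mul1n ?mul0n ?cardfs0.
apply/fsetP => A; rewrite [LHS]in_fset /= inE.
have [PA|PA] := boolP (A \in partitions S_set N).
  by rewrite parity //; case: (odd N); rewrite ?PA ?inE.
by rewrite andFb; case: (odd N); rewrite ?(negbTE PA) ?inE.
Qed.

Lemma part_prod_identity (R : comNzRingType) (q : R) M n :
  q ^+ M = 0 -> (M.+1 + M.+1 <= n)%N ->
  part_prod S_set (n * 6) q - part_prod S_set (n * 6) (- q)
  = 12 * q + 64 * q ^+ 3 * part_prod T_set (n * 6) q.
Proof.
move=> qM le_n.
have NqM : (- q) ^+ M = 0 by rewrite exprNn qM mulr0.
rewrite (part_prod_S qM) ?(part_prod_S NqM) ?(part_prod_T qM); try lia.
exact: modular_equation qM le_n.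
Qed.

Lemma rmorph_part_prod (R R' : comNzRingType) (f : {rmorphism R -> R'})
    (C : finType) (X : pred (colored C)) L (x : R) :
  f (part_prod X L x) = part_prod X L (f x).
Proof.
rewrite /part_prod rmorph_prod; apply: eq_bigr => i _.
rewrite rmorph_prod; apply: eq_bigr => c _.
by case: ifP; rewrite ?rmorph1 // rmorphD rmorphXn rmorph1.
Qed.

(** Here f is the reduction modulo a power of 'X; it is kept abstract so that no
    computation takes place in the quotient ring. *)
Lemma rmorph_part_prod_identity (R R' : comNzRingType) (f : {rmorphism R -> R'})
    (x : R) M n :
  f x ^+ M = 0 -> (M.+1 + M.+1 <= n)%N ->
  f (part_prod S_set (n * 6) x - part_prod S_set (n * 6) (- x))
  = f (x *+ 12 + (x ^+ 3 * part_prod T_set (n * 6) x) *+ 64).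
Proof.
move=> fM le_n; have := part_prod_identity fM le_n.
rewrite rmorphB rmorphD !rmorphMn rmorphM rmorphXn !rmorph_part_prod rmorphN => ->.
by ring.
Qed.

Lemma in_qpoly_Xn (A : comNzRingType) (M : nat) :
  (in_qpoly 'X^(M.+1) 'X : {poly %/ 'X^(M.+1) : {poly A}}) ^+ M.+1 = 0.
Proof.
have h : Pdiv.CommonRing.rmodp 'X^(M.+1) (mk_monic 'X^(M.+1)) = 0 :> {poly A}.
  by rewrite mk_monic_Xn; apply/Pdiv.RingMonic.rmodpp/monicXn.
by rewrite -rmorphXn; apply: val_inj.
Qed.

(** Comparison of the coefficients of 'X^N; the term 12 q does not contribute
    because N is not 1. *)
Lemma card_partitions_S_T (N : nat) : (3 <= N)%N ->
  (1 - (-1) ^+ N) * #|` partitions S_set N|%fset%:Z =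
  #|` partitions T_set (N - 3)|%fset%:Z *+ 64.
Proof.
move=> le_3N.
(* The bound is hidden because simplification would unfold it. *)
have [n le_n] : exists n, (N.+2 + N.+2 <= n)%N by exists (N.+2 + N.+2)%N.
have := rmorph_part_prod_identity (in_qpoly_Xn int N) le_n.
move/eq_coef_in_qpoly => /(_ N (leqnn _)).
have -> : part_prod S_set (n * 6) (- 'X) =
    part_prod S_set (n * 6) ((-1) *: 'X) :> {poly int} by rewrite scaleN1r.
have onE (X : pred (colored color)) : part_prod X (n * 6) 'X =
    part_prod X (n * 6) (1 *: 'X) :> {poly int} by rewrite scale1r.
rewrite !onE coefB coefD !coefMn coefX coefXnM ltnNge le_3N /=.
rewrite !coef_part_prod; try lia.
rewrite !expr1n !mul1r (_ : (N == 1)%N = false) ?mul0rn ?add0r; last by lia.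
by rewrite mulrBl mul1r natz natz.
Qed.

Local Close Scope ring_scope.

Theorem theorem3p8 (N : nat) (hN : 3 <= N) : D_S N = 32 * D_T (N - 3).
Proof.
have := card_partitions_S_T hN; rewrite D_S_parity /D_T -signr_odd.
by case: odd; rewrite /= ?expr1 ?expr0; lia.
Qed.
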